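(* Let $q$ be a prime power, and let $n$ be a positive integer. Then $$q^{\frac{n(n-1)}{2}} \prod_{i=1}^{n-1} (q^n - q^i) = \frac{1}{q^{3n^{2}}}\sum_{m=0}^{n}\sum_{k=0}^{n}\frac{q^{kn+(n-k)m+\frac{k(k-1)}{2}+\frac{m(m-1)}{2}}}{\prod_{i=1}^{k} (q^i-1) \prod_{i=1}^{m} (q^i-1)}\, S_{m,k},$$ where $$S_{m,k}=\sum_{\ell=0}^{n-\max\{k,m\}}(-1)^{\ell}\, q^{\frac{\ell(\ell-1)}{2}}\prod_{i=\ell+1}^{3n-k-\ell-m-1}(q^i-1) \prod_{i=n-k-\ell+1}^{n} (q^i-1) \prod_{i=n-m-\ell+1}^{n} (q^i-1).$$
   Context: Empty products (upper limit smaller than lower limit) equal $1$. *)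

(* Defs.v *)
From mathcomp Require Import all_boot all_order all_algebra.

Set Implicit Arguments.
Unset Strict Implicit.
Unset Printing Implicit Defensive.

Import GRing.Theory.
Local Open Scope ring_scope.

Definition prime_power (q : nat) : Prop :=
  exists p e : nat, [/\ prime p, (0 < e)%N & q = (p ^ e)%N].

(* A product over a <= i <= b is written \prod_(a <= i < b.+1).
   On the range l <= n - max(k, m), with k, m <= n and n > 0, one has
   k + l <= n and m + l <= n, hence k + l + m <= 2n <= 3n - 1, so no bound
   below involves a truncated subtraction; l - 1 is truncated only at l = 0,
   where the exponent l * (l - 1) %/ 2 is 0 anyway. *)
Definition Ssum (q n m k : nat) : rat :=
  \sum_(0 <= l < (n - maxn k m).+1)
    (-1) ^+ l * q%:R ^+ (l * (l - 1) %/ 2)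
    * (\prod_(l + 1 <= i < (3 * n - k - l - m - 1).+1) (q%:R ^+ i - 1))
    * (\prod_(n - k - l + 1 <= i < n.+1) (q%:R ^+ i - 1))
    * (\prod_(n - m - l + 1 <= i < n.+1) (q%:R ^+ i - 1)).

(* Main.v *)
Require Import Defs.
From mathcomp Require Import all_boot all_order all_algebra.
From mathcomp Require Import ring zify.

Import GRing.Theory Num.Theory.
Local Open Scope ring_scope.

(** Write f(j) for the product of the q^i - 1 over 1 <= i <= j, [n; k] for the
Gaussian binomial, and (y)_s for the product of the y q^i - 1 over i < s.
Everything rests on one polynomial identity, the q-Vandermonde sum
[sum_qbin_prod]:
    sum_l [A; l] prod_{i<l} (q^i - w) (y)_{A-l} = prod_{i<A} (y q^i - w),
which holds over any commutative ring and follows from the q-Pascal rule.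

The identity is used at two specializations. With A = n - k, B = n - m,
w = q^B and y = q^(n+B), its left side is S_{m,k} up to factors free of l,
because (-1)^l q^(l(l-1)/2) f(B) / f(B-l) is the product of the q^i - q^B over
i < l; this evaluates S_{m,k} ([Ssum_closed]) as
    f(n)^2 f(n-1) q^(A B) (q^n)_A (q^n)_B / (f(A) f(B)).
The only factors of the summand that couple k and m are now q^((n-k) m) and
q^(A B), and
    k n + (n-k) m + (n-k) (n-m) = n^2,
so the double sum is f(n-1) q^(n^2) times the square of the single sum
sum_k [n; k] q^(k(k-1)/2) (q^n)_{n-k}. At w = 0 and y = q^n the same identity
evaluates this single sum as the product of the q^(n+i) over i < n, and the
powers of q add up to the left-hand side. *)

(** * Gaussian binomials and the q-Vandermonde sum *)

Definition qfact {R : pzRingType} (q : R) (n : nat) : R :=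
  \prod_(1 <= i < n.+1) (q ^+ i - 1).

Definition qpoch {R : pzRingType} (q y : R) (n : nat) : R :=
  \prod_(i < n) (y * q ^+ i - 1).

(** The recursive form avoids division, so that the q-Vandermonde sum holds
over every commutative ring, and makes [n; k] vanish for k > n. *)
Fixpoint qbin {R : pzRingType} (q : R) (n k : nat) : R :=
  match n, k with
  | _, 0 => 1
  | 0, _.+1 => 0
  | n'.+1, k'.+1 => qbin q n' k' + q ^+ k * qbin q n' k
  end.

Lemma qfactS {R : pzRingType} (q : R) n :
  qfact q n.+1 = qfact q n * (q ^+ n.+1 - 1).
Proof. by rewrite /qfact big_nat_recr. Qed.

Lemma qfact0 {R : pzRingType} (q : R) : qfact q 0 = 1.
Proof. by rewrite /qfact big_geq. Qed.

Lemma qfact_neq0 {R : idomainType} (q : R) :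
  (forall i, q ^+ i.+1 - 1 != 0) -> forall n, qfact q n != 0.
Proof.
move=> q_reg; elim=> [|n IHn]; first by rewrite qfact0 oner_neq0.
by rewrite qfactS mulf_neq0.
Qed.

Lemma qpochS {R : pzRingType} (q y : R) n :
  qpoch q y n.+1 = qpoch q y n * (y * q ^+ n - 1).
Proof. by rewrite /qpoch big_ord_recr. Qed.

Lemma qpochD {R : pzRingType} (q y : R) m n :
  qpoch q y (m + n) = qpoch q y m * qpoch q (y * q ^+ m) n.
Proof.
rewrite /qpoch big_split_ord /=; congr (_ * _).
by apply: eq_bigr => i _; rewrite exprD mulrA.
Qed.

Lemma qfactD {R : pzRingType} (q : R) m n :
  qfact q (m + n) = qfact q m * qpoch q (q ^+ m.+1) n.
Proof.
elim: n => [|n IHn]; first by rewrite addn0 /qpoch big_ord0 mulr1.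
by rewrite addnS qfactS IHn qpochS mulrA -exprD addSn.
Qed.

Lemma prod_range_qfact {R : pzRingType} (q : R) a b :
  (a <= b)%N ->
  qfact q a * \prod_(a + 1 <= i < b.+1) (q ^+ i - 1) = qfact q b.
Proof. by move=> le_ab; rewrite /qfact addn1 -big_cat_nat. Qed.

Lemma qbin0 {R : pzRingType} (q : R) n : qbin q n 0 = 1.
Proof. by case: n. Qed.

Lemma qbin_small {R : pzRingType} (q : R) n k : (n < k)%N -> qbin q n k = 0.
Proof.
elim: n k => [|n IHn] [|k] //= lt_nk.
by rewrite !IHn ?mulr0 ?addr0 // ltnW.
Qed.

Lemma qbin_qfact {R : comPzRingType} (q : R) n k :
  (k <= n)%N -> qbin q n k * qfact q k * qfact q (n - k) = qfact q n.
Proof.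
elim: n k => [|n IHn] [|k] le_kn //.
- by rewrite qbin0 qfact0 !mulr1.
- by rewrite qbin0 subn0 qfact0 !mul1r.
rewrite /= subSS [in RHS]qfactS -[in RHS](IHn k) //.
have [-> | neq_kn] := eqVneq k n.
  by rewrite (qbin_small _ _ _ (ltnSn n)) mulr0 addr0 qfactS; ring.
have lt_kn : (k < n)%N by rewrite ltn_neqAle neq_kn.
have := IHn _ lt_kn; rewrite -(IHn k) // -(subnSK lt_kn) !qfactS.
have -> : q ^+ n.+1 = q ^+ k.+1 * q ^+ (n - k.+1).+1.
  by rewrite -exprD; congr (_ ^+ _); lia.
set d := (n - k.+1)%N => pascal.
transitivity (qbin q n k * (qfact q k * (q ^+ k.+1 - 1))
    * (qfact q d * (q ^+ d.+1 - 1))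
  + q ^+ k.+1 * (q ^+ d.+1 - 1)
    * (qbin q n k.+1 * (qfact q k * (q ^+ k.+1 - 1)) * qfact q d)).
  by ring.
by rewrite pascal; ring.
Qed.

(** By the q-Pascal rule, each term of index l at rank n contributes to the sum
at rank n + 1 with the factor (q^l - w) + q^l (y q^(n-l) - 1) = y q^n - w, which
does not depend on l. *)
Lemma sum_qbin_prod {R : comPzRingType} (q w y : R) n :
  \sum_(l < n.+1) qbin q n l * \prod_(i < l) (q ^+ i - w) * qpoch q y (n - l)
  = \prod_(i < n) (y * q ^+ i - w).
Proof.
elim: n => [|n IHn].
  by rewrite big_ord_recl big_ord0 /qpoch /= !big_ord0 !mulr1 addr0.
rewrite [RHS]big_ord_recr /= -IHn mulr_suml.
have split_sum : \sum_(l < n.+2)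
    qbin q n.+1 l * \prod_(i < l) (q ^+ i - w) * qpoch q y (n.+1 - l)
  = \sum_(l < n.+1)
      qbin q n l * \prod_(i < l.+1) (q ^+ i - w) * qpoch q y (n - l)
  + \sum_(l < n.+2) q ^+ l * qbin q n l
      * \prod_(i < l) (q ^+ i - w) * qpoch q y (n.+1 - l).
  rewrite big_ord_recl [X in _ = _ + X]big_ord_recl /= qbin0 !mul1r.
  rewrite [RHS]addrCA; congr (_ + _); rewrite -big_split /=.
  by apply: eq_bigr => i _; rewrite /bump add1n subSS -!mulrDl.
rewrite split_sum [X in _ + X]big_ord_recr /= (qbin_small _ _ _ (ltnSn n)).
rewrite mulr0 !mul0r addr0 -big_split /=.
apply: eq_bigr => l _.
have le_ln : (l <= n)%N by rewrite -ltnS.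
rewrite subSn // qpochS big_ord_recr /=.
have -> : q ^+ n = q ^+ l * q ^+ (n - l) by rewrite -exprD subnKC.
by ring.
Qed.

Lemma prod_exp_bin2 {R : pzRingType} (q : R) n :
  \prod_(i < n) q ^+ i = q ^+ (n * (n - 1) %/ 2).
Proof.
by rewrite divn2 subn1 -bin2 -bin2_sum expr_sum big_mkord.
Qed.

(** Division-free form of the falling product
(q^B - 1) ... (q^(B-l+1) - 1) = f(B) / f(B-l), with q^i taken out of each
factor; it turns the sign, the power of q and one quotient of the inner sum into
the product that the q-Vandermonde sum expects. *)
Lemma prod_exp_sub {R : comPzRingType} (q : R) B l :
  (l <= B)%N ->
  (\prod_(i < l) (q ^+ i - q ^+ B)) * qfact q (B - l)
  = (-1) ^+ l * q ^+ (l * (l - 1) %/ 2) * qfact q B.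
Proof.
rewrite -prod_exp_bin2.
elim: l => [|l IHl] lt_lB; first by rewrite !big_ord0 subn0 mulr1.
have := IHl (ltnW lt_lB); rewrite !big_ord_recr /= exprS -(subnSK lt_lB) qfactS.
set P := \prod_(i < l) (_ - _); set d := (B - l.+1)%N => IH.
have -> : q ^+ B = q ^+ l * q ^+ d.+1.
  by rewrite -exprD /d; congr (_ ^+ _); lia.
transitivity (- q ^+ l * (P * (qfact q d * (q ^+ d.+1 - 1)))); first by ring.
by rewrite IH; ring.
Qed.

(** * Evaluation of the inner sum *)

(** For l <= A, (z)_{A+B-l} = (z)_B (z q^B)_{A-l}. With (z)_B taken out, this is
the q-Vandermonde sum at w = q^B and y = z q^B, whose right-hand factors
z q^B q^i - q^B are then divisible by q^B. *)
Lemma sum_alternating_qpoch {R : comPzRingType} (q z : R) A B :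
  \sum_(0 <= l < A.+1)
    qbin q A l * \prod_(i < l) (q ^+ i - q ^+ B) * qpoch q z (A + B - l)
  = q ^+ (A * B) * qpoch q z A * qpoch q z B.
Proof.
transitivity (qpoch q z B * \prod_(i < A) (z * q ^+ B * q ^+ i - q ^+ B)).
  rewrite -sum_qbin_prod mulr_sumr big_mkord; apply: eq_bigr => l _.
  have -> : (A + B - l = B + (A - l))%N by have := ltn_ord l; lia.
  by rewrite qpochD; ring.
under eq_bigr => i _.
  have -> : z * q ^+ B * q ^+ i - q ^+ B = q ^+ B * (z * q ^+ i - 1) by ring.
  over.
rewrite big_split /= prodr_const card_ord -exprM mulnC /qpoch.
by ring.
Qed.

(** Up to factors free of l, the summand of index l is that of
[sum_alternating_qpoch] at z = q^n with A = n - k and B = n - m. Here the index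
runs over l <= min(A, B) and there over l <= A, the additional terms being 0. *)
Lemma Ssum_closed (q n m k : nat) :
  (forall i, q%:R ^+ i.+1 - 1 != 0 :> rat) ->
  (0 < n)%N -> (k <= n)%N -> (m <= n)%N ->
  let Q : rat := q%:R in
  Ssum q n m k * (qfact Q (n - k) * qfact Q (n - m))
  = qfact Q n ^+ 2 * qfact Q n.-1 * Q ^+ ((n - k) * (n - m))
    * (qpoch Q (Q ^+ n) (n - k) * qpoch Q (Q ^+ n) (n - m)).
Proof.
move=> q_reg n_gt0 le_kn le_mn Q.
have f_neq0 := qfact_neq0 Q q_reg.
have [-> ->] : k = (n - (n - k))%N /\ m = (n - (n - m))%N by lia.
have: (n - k <= n)%N /\ (n - m <= n)%N by lia.
move: (n - k)%N (n - m)%N => A B [le_An le_Bn] {k m le_kn le_mn}.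
rewrite !subKn // -mulrA (mulrA (Q ^+ (A * B))) -sum_alternating_qpoch.
rewrite /Ssum mulr_suml mulr_sumr.
have -> : (n - maxn (n - A) (n - B) = minn A B)%N by lia.
(* Terms with l > B vanish: their product contains the factor of index B. *)
rewrite [RHS](@big_cat_nat _ _ _ (minn A B).+1) //=; last by lia.
rewrite [X in _ = _ + X]big_nat_cond [X in _ = _ + X]big1 ?addr0; last first.
  move=> l /andP[/andP[lt_l lt_lA] _].
  have lt_Bl : (B < l)%N by lia.
  by rewrite (bigD1 (Ordinal lt_Bl)) //= subrr !(mul0r, mulr0).
apply: eq_big_nat => l /andP[_ lt_l].
have [le_lA le_lB] : (l <= A)%N /\ (l <= B)%N by lia.
have prod_top C : (l <= C)%N -> (C <= n)%N ->
    \prod_(n - (n - C) - l + 1 <= i < n.+1) (Q ^+ i - 1)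
    = qfact Q n / qfact Q (C - l).
  move=> le_lC le_Cn; rewrite subKn // -(@prod_range_qfact _ Q (C - l) n).
    by rewrite mulrC mulKf.
  by lia.
rewrite (prod_top A) // (prod_top B) //.
have -> : (3 * n - (n - A) - l - (n - B) - 1 = n.-1 + (A + B - l))%N by lia.
have := @prod_range_qfact _ Q l (n.-1 + (A + B - l)).
rewrite qfactD prednK // => /(_ _)/(canRL (mulKf (f_neq0 l))) ->; last lia.
have := prod_exp_sub Q B l le_lB => /(canRL (mulfK (f_neq0 _))) ->.
rewrite -(qbin_qfact Q A l le_lA).
have := f_neq0 l; have := f_neq0 (A - l)%N.
have := f_neq0 (B - l)%N.
by move=> *; field; do ?[apply/andP; split].
Qed.

(** * The double sum *)

Theorem theorem2 (q n : nat) (hq : prime_power q) (hn : (0 < n)%N) :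
  q%:R ^+ (n * (n - 1) %/ 2)
    * (\prod_(1 <= i < (n - 1).+1) (q%:R ^+ n - q%:R ^+ i))
  = 1 / q%:R ^+ (3 * n ^ 2)
    * \sum_(0 <= m < n.+1) \sum_(0 <= k < n.+1)
        q%:R ^+ (k * n + (n - k) * m + k * (k - 1) %/ 2 + m * (m - 1) %/ 2)
        / ((\prod_(1 <= i < k.+1) (q%:R ^+ i - 1))
           * (\prod_(1 <= i < m.+1) (q%:R ^+ i - 1)))
        * Ssum q n m k :> rat.
Proof.
have q_gt1 : (1 < q)%N.
  by case: hq => p [e [p_pr e_gt0 ->]]; rewrite -(exp1n e) ltn_exp2r ?prime_gt1.
have q_reg i : q%:R ^+ i.+1 - 1 != 0 :> rat.
  by rewrite -natrX subr_eq0 pnatr_eq1 -(exp1n i.+1) eqn_exp2r // gtn_eqF.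
pose Q : rat := q%:R.
have Q_neq0 : Q != 0 by rewrite pnatr_eq0 -lt0n ltnW.
have f_neq0 := qfact_neq0 Q q_reg.
(* Up to sign the product is prod_exp_sub at l = B = n without its factor i = 0;
   up to sign, that factor is the last factor q^n - 1 of f(n). *)
have lhsE : \prod_(1 <= i < (n - 1).+1) (Q ^+ n - Q ^+ i)
    = Q ^+ (n * (n - 1) %/ 2) * qfact Q n.-1.
  have := prod_exp_sub Q n n (leqnn n).
  rewrite subnn qfact0 mulr1 -(prednK hn) qfactS prednK // => full_prod.
  have top_neq0 : Q ^+ n - 1 != 0 by rewrite -(prednK hn).
  apply: (mulfI top_neq0).
  have -> : (Q ^+ n - 1) * \prod_(1 <= i < (n - 1).+1) (Q ^+ n - Q ^+ i)
      = \prod_(i < n) - (Q ^+ i - Q ^+ n).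
    rewrite subn1 prednK // -(big_mkord xpredT (fun i => - (Q ^+ i - Q ^+ n))).
    rewrite [RHS]big_ltn // expr0 opprB; congr (_ * _).
    by apply: eq_bigr => i _; rewrite opprB.
  rewrite prodrN card_ord full_prod -[RHS]mul1r.
  by rewrite -[X in _ = X * _](sqrr_sign _ n); ring.
pose g k := qbin Q n k * Q ^+ (k * (k - 1) %/ 2) * qpoch Q (Q ^+ n) (n - k).
(* The q-Vandermonde sum at w = 0 and y = q^n. *)
have sum_g : \sum_(0 <= k < n.+1) g k
    = Q ^+ (n * n) * Q ^+ (n * (n - 1) %/ 2).
  have := sum_qbin_prod Q 0 (Q ^+ n) n.
  under eq_bigr do under eq_bigr do rewrite subr0.
  under [in X in _ = X]eq_bigr do rewrite subr0.
  rewrite big_split /= prodr_const card_ord -exprM prod_exp_bin2 => <-.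
  by rewrite big_mkord; apply: eq_bigr => l _; rewrite /g -prod_exp_bin2.
rewrite -/Q lhsE.
transitivity (1 / Q ^+ (3 * n ^ 2)
  * (qfact Q n.-1 * Q ^+ (n * n)
     * ((\sum_(0 <= k < n.+1) g k) * (\sum_(0 <= k < n.+1) g k)))).
  rewrite sum_g.
  have -> : Q ^+ (3 * n ^ 2) = Q ^+ (n * n) * Q ^+ (n * n) * Q ^+ (n * n).
    by rewrite -!exprD; congr (_ ^+ _); rewrite -mulnn; lia.
  by field; rewrite expf_neq0.
congr (_ * _); rewrite big_distrlr mulr_sumr /=.
apply: eq_big_nat => m /andP[_ le_mn]; rewrite mulr_sumr.
apply: eq_big_nat => k /andP[_ le_kn]; rewrite ltnS in le_mn le_kn.
rewrite -/(qfact Q k) -/(qfact Q m) /g.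
have := Ssum_closed q n m k q_reg hn le_kn le_mn; cbv zeta; rewrite -/Q.
move=> /(canRL (mulfK (mulf_neq0 (f_neq0 _) (f_neq0 _)))) ->.
(* The mixed exponents of k and m add up to n^2, which decouples the sums. *)
have -> : Q ^+ (n * n) = Q ^+ (k * n + (n - k) * m) * Q ^+ ((n - k) * (n - m)).
  by rewrite -exprD; congr (_ ^+ _); nia.
rewrite 2!(exprD _ (_ + _)) expr2.
rewrite -{1}(qbin_qfact Q n k le_kn) -{1}(qbin_qfact Q n m le_mn).
have := f_neq0 k; have := f_neq0 m.
have := f_neq0 (n - k)%N; have := f_neq0 (n - m)%N.
by move=> *; field; do ?[apply/andP; split].
Qed.
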